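(* Let $K$ be a field of characteristic $p>0$, let $n,d,h$ be positive integers, and let $f\in K[[x_1,\ldots,x_n]]$ be an algebraic power series of degree at most $d$ and height at most $h$. Then there exists an effective constant $A:=A(n,d,h)$, depending only on $n$, $d$ and $h$, such that $\Delta(f)$ is algebraic over $K(x)$ of degree at most $p^{A}$ and height at most $A^2p^{A+1}$.
   Context: For $g=\sum_{(i_1,\ldots,i_n)\in\mathbb{N}^n}a(i_1,\ldots,i_n)x_1^{i_1}\cdots x_n^{i_n}\in K[[x_1,\ldots,x_n]]$, the diagonal is $\Delta(g)(x):=\sum_{m\ge0}a(m,\ldots,m)x^m\in K[[x]]$. A power series $g\in K[[x_1,\ldots,x_n]]$ is algebraic if there are polynomials $A_0,\ldots,A_m\in K[x_1,\ldots,x_n]$, not all zero, with $\sum_{i=0}^m A_i g^i=0$; its degree is the least such $m$. The height of a polynomial $P(Y)\in K[x_1,\ldots,x_n][Y]$ is the maximum of the total degrees of its coefficients, and the height of an algebraic $g$ is the minimum of the heights of the nonzero polynomials $P(Y)\in K[x_1,\ldots,x_n][Y]$ with $P(g)=0$ (for $n=1$, with variable $x$). *)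

(* Defs.v *)
From HB Require Import structures.
From mathcomp Require Import all_boot all_order all_algebra.
From mathcomp Require Import mpoly.

Set Implicit Arguments.
Unset Strict Implicit.
Unset Printing Implicit Defensive.

Import GRing.Theory.
Local Open Scope ring_scope.

Definition is_least (S : nat -> Prop) (m : nat) : Prop :=
  S m /\ forall k : nat, S k -> (m <= k)%N.

(* [mpseries n K] is K[[x_1, ..., x_n]]: a series is its coefficient family,
   indexed by the same multi-indices as the monomials of {mpoly K[n]}. *)
Definition mpseries (n : nat) (K : fieldType) : Type := 'X_{1..n} -> K.

Section PowerSeries.
Variables (n : nat) (K : fieldType).
Implicit Types (f g : mpseries n K) (P : {poly {mpoly K[n]}}).

Definition ps_of_mpoly (A : {mpoly K[n]}) : mpseries n K := fun m => A@_m.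

(* Cauchy product. The bounds on k only make the index type finite: every pair
   with k.1 + k.2 = m satisfies them (compare [mcoeffM]). *)
Definition ps_mul f g : mpseries n K := fun m =>
  \sum_(k : 'X_{1..n < (mdeg m).+1, (mdeg m).+1} | m == (k.1 + k.2)%MM)
     f k.1 * g k.2.

Definition ps_exp g (i : nat) : mpseries n K :=
  iter i (ps_mul g) (ps_of_mpoly 1).

Definition ps_eval P g : mpseries n K := fun m =>
  \sum_(i < size P) ps_mul (ps_of_mpoly P`_i) (ps_exp g i) m.

Definition ps_root P g : Prop := forall m, ps_eval P g m = 0.

Definition ps_algebraic g : Prop := exists P, P != 0 /\ ps_root P g.

(* A nonzero P of size at most m.+1 is a family A_0, ..., A_m not all zero. *)
Definition ps_degree g : nat -> Prop :=
  is_least (fun m => exists P, [/\ P != 0, (size P <= m.+1)%N & ps_root P g]).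

(* [msize] is one more than the total degree; the zero coefficients of P
   contribute 0 to the maximum. *)
Definition pheight P : nat := \max_(i < size P) (msize P`_i).-1.

Definition ps_height g : nat -> Prop :=
  is_least (fun h => exists P, [/\ P != 0, ps_root P g & pheight P = h]).

Definition degree_at_most g (d : nat) : Prop :=
  exists2 m, ps_degree g m & (m <= d)%N.

Definition height_at_most g (h : nat) : Prop :=
  exists2 m, ps_height g m & (m <= h)%N.

Definition diagonal f : mpseries 1 K :=
  fun m => f [multinom m ord0 | _ < n].

End PowerSeries.

(* Total recursive functions: the least class containing zero, successor and
   the projections that is closed under composition, primitive recursion and
   minimization of regular functions. *)
Inductive recursive : forall k : nat, (k.-tuple nat -> nat) -> Prop :=
| Rec_zero : recursive (fun _ : 0.-tuple nat => 0%N)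
| Rec_succ : recursive (fun v : 1.-tuple nat => (thead v).+1)
| Rec_proj (k : nat) (i : 'I_k) :
    recursive (fun v : k.-tuple nat => tnth v i)
| Rec_comp (k l : nat) (f : l.-tuple nat -> nat)
    (g : 'I_l -> k.-tuple nat -> nat) :
    recursive f -> (forall i, recursive (g i)) ->
    recursive (fun v : k.-tuple nat => f [tuple g i v | i < l])
| Rec_primrec (k : nat) (f : k.-tuple nat -> nat)
    (g : k.+2.-tuple nat -> nat) (r : k.+1.-tuple nat -> nat) :
    recursive f -> recursive g ->
    (forall v : k.-tuple nat, r [tuple of 0%N :: v] = f v) ->
    (forall (i : nat) (v : k.-tuple nat),
       r [tuple of i.+1 :: v] = g [tuple of i :: r [tuple of i :: v] :: v]) ->
    recursive r
| Rec_min (k : nat) (g : k.+1.-tuple nat -> nat) (f : k.-tuple nat -> nat) :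
    recursive g ->
    (forall v : k.-tuple nat,
       is_least (fun i => g [tuple of i :: v] = 0%N) (f v)) ->
    recursive f.

(* Main.v *)
(* For a root [f] of [P] with [D = P'(f)] nonzero and a power [q] of the
   characteristic, Taylor expansion of [Q P^(q-1)] at [f] shows that
   [D^(q-1) Q(f)] is the sum of the [Z_(jq+q-1) f^(jq)], where [Z = Q P^(q-1)].
   Hence the Cartier-type section of index [i], which keeps the coefficients of
   multi-index [q m + (i, ..., i)], sends a series [g] with [D g = Q(f)] to a
   series [g'] with [D' g' = S(f')], where [f'] and [D'] have the coefficients of
   [f] and [D] raised to the power [q] and [S] has degree and height bounded in
   terms of [n], [d] and [h] only.  Keeping the coefficients instead of taking
   their [q]-th roots makes the sections linear over any [K], perfect or not.

   There are [(M+1) q] series [(x_1 ... x_n)^s f^(p^k)], [k <= M], [s < q], where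
   [M] is the dimension of the space of admissible [S] and [q = p^M], and their
   [q] sections lie in spaces of dimension [M]; so some nontrivial combination of
   them has all its sections zero, hence a zero diagonal, and as taking diagonals
   commutes with [p]-th powers this is an equation for [diagonal f].

   A polynomial satisfying both bounds at once exists because [K[x_1, ..., x_n]]
   is factorial: an annihilator of minimal degree, then of minimal height, divides
   all the others.  If [P'] vanishes, [P] is a polynomial in [y^p] that
   annihilates [f^p], so a separable equation is reached after at most [d] steps. *)
Require Import Defs.
From HB Require Import structures.
From mathcomp Require Import all_boot all_order all_algebra.
From mathcomp Require Import mpoly.
From mathcomp Require Import boolp ring zify.

Set Implicit Arguments.
Unset Strict Implicit.
Unset Printing Implicit Defensive.

Import GRing.Theory.
Local Open Scope ring_scope.

(** * Power series *)

HB.instance Definition _ n (K : fieldType) := gen_eqMixin (mpseries n K).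
HB.instance Definition _ n (K : fieldType) := gen_choiceMixin (mpseries n K).

Section SeriesRing.
Variables (n : nat) (K : fieldType).
Implicit Types (f g h : mpseries n K) (m : 'X_{1..n}) (A B : {mpoly K[n]}).

Lemma psP f g : (forall m, f m = g m) -> f = g.
Proof. exact: funext. Qed.

Definition ps_add f g : mpseries n K := fun m => f m + g m.
Definition ps_opp f : mpseries n K := fun m => - f m.

Fact ps_addA : associative ps_add.
Proof. by move=> f g h; apply: psP => m; apply: addrA. Qed.
Fact ps_addC : commutative ps_add.
Proof. by move=> f g; apply: psP => m; apply: addrC. Qed.
Fact ps_add0 : left_id (ps_of_mpoly 0) ps_add.
Proof. by move=> f; apply: psP => m; rewrite /ps_add /ps_of_mpoly mcoeff0 add0r. Qed.
Fact ps_addN : left_inverse (ps_of_mpoly 0) ps_opp ps_add.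
Proof.
by move=> f; apply: psP => m; rewrite /ps_add /ps_opp /ps_of_mpoly mcoeff0 addNr.
Qed.

HB.instance Definition _ :=
  GRing.isZmodule.Build (mpseries n K) ps_addA ps_addC ps_add0 ps_addN.

Definition ps_trunc (N : nat) f : {mpoly K[n]} :=
  \sum_(m : 'X_{1..n < N}) f m *: 'X_[m].

Lemma mcoeff_trunc N f m : (mdeg m < N)%N -> (ps_trunc N f)@_m = f m.
Proof. exact: mcoeff_mpoly. Qed.

(** Only coefficients of degree at most [mdeg m] enter, so series may be replaced by polynomials
    agreeing with them that far. Commutativity, associativity and the unit law are transferred from
    [{mpoly K[n]}] in this way. *)
Lemma ps_mul_mcoeff f g A B m :
  (forall k, (mdeg k <= mdeg m)%N -> f k = A@_k) ->
  (forall k, (mdeg k <= mdeg m)%N -> g k = B@_k) ->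
  ps_mul f g m = (A * B)@_m.
Proof.
move=> fA gB; rewrite mcoeffM; apply: eq_bigr => k _.
by rewrite fA ?gB // -ltnS bmdeg.
Qed.

Lemma ps_mul_trunc f g m :
  ps_mul f g m = (ps_trunc (mdeg m).+1 f * ps_trunc (mdeg m).+1 g)@_m.
Proof. by apply: ps_mul_mcoeff => k km; rewrite mcoeff_trunc. Qed.

Fact ps_mulC : commutative (@ps_mul n K).
Proof. by move=> f g; apply: psP => m; rewrite !ps_mul_trunc mulrC. Qed.

Lemma ps_trunc_mul N f g k : (mdeg k < N)%N ->
  ps_mul f g k = (ps_trunc N f * ps_trunc N g)@_k.
Proof.
by move=> kN; apply: ps_mul_mcoeff => l lk; rewrite mcoeff_trunc //;
   apply: leq_ltn_trans kN.
Qed.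

Fact ps_mulA : associative (@ps_mul n K).
Proof.
move=> f g h; apply: psP => m; pose T := ps_trunc (mdeg m).+1.
rewrite (@ps_mul_mcoeff _ _ (T f) (T g * T h)); first last.
- by move=> k km; apply: ps_trunc_mul.
- by move=> k km; rewrite mcoeff_trunc.
rewrite (@ps_mul_mcoeff _ _ (T f * T g) (T h)) ?mulrA //.
- by move=> k km; apply: ps_trunc_mul.
by move=> k km; rewrite mcoeff_trunc.
Qed.

Fact ps_mul1 : left_id (ps_of_mpoly 1) (@ps_mul n K).
Proof.
move=> f; apply: psP => m.
rewrite (@ps_mul_mcoeff _ _ 1 (ps_trunc (mdeg m).+1 f)) ?mul1r ?mcoeff_trunc //.
by move=> k km; rewrite mcoeff_trunc.
Qed.

Fact ps_mulDl : left_distributive (@ps_mul n K) +%R.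
Proof.
move=> f g h; apply: psP => m; apply: etrans (big_split _ _ _ _ _) => /=.
by apply: eq_bigr => k _; rewrite -mulrDl.
Qed.

Fact ps_one_neq0 : ps_of_mpoly (1 : {mpoly K[n]}) != 0.
Proof.
apply/eqP => /(congr1 (fun f : mpseries n K => f 0%MM)).
rewrite [RHS]mcoeff0 /ps_of_mpoly mcoeff1 eqxx => /eqP; exact/negP/oner_neq0.
Qed.

HB.instance Definition _ :=
  GRing.Zmodule_isComNzRing.Build (mpseries n K)
    ps_mulA ps_mulC ps_mul1 ps_mulDl ps_one_neq0.

Lemma ps0E m : (0 : mpseries n K) m = 0.
Proof. exact: mcoeff0. Qed.

Lemma psDE f g m : (f + g) m = f m + g m.
Proof. by []. Qed.

Lemma ps_sumE (I : Type) (r : seq I) (P : pred I) (F : I -> mpseries n K) m :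
  (\sum_(i <- r | P i) F i) m = \sum_(i <- r | P i) F i m.
Proof. by elim/big_rec2: _ => [|i x y _ <-]; rewrite ?ps0E ?psDE. Qed.

Fact ps_of_mpoly_is_zmod_morphism : zmod_morphism (@ps_of_mpoly n K).
Proof. by move=> A B; apply: psP => m; rewrite /ps_of_mpoly mcoeffB. Qed.
Fact ps_of_mpoly_is_monoid_morphism : monoid_morphism (@ps_of_mpoly n K).
Proof.
by split=> // A B; apply: psP => m; apply/esym; apply: ps_mul_mcoeff.
Qed.

HB.instance Definition _ :=
  GRing.isZmodMorphism.Build {mpoly K[n]} (mpseries n K) (@ps_of_mpoly n K)
    ps_of_mpoly_is_zmod_morphism.
HB.instance Definition _ :=
  GRing.isMonoidMorphism.Build {mpoly K[n]} (mpseries n K) (@ps_of_mpoly n K)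
    ps_of_mpoly_is_monoid_morphism.

Lemma ps_of_mpoly_inj : injective (@ps_of_mpoly n K).
Proof.
move=> A B AB; apply/mpolyP => m.
exact: (congr1 (fun f : mpseries n K => f m) AB).
Qed.

Lemma ps_exp_expr f i : ps_exp f i = f ^+ i.
Proof. by elim: i => [|i IH]; rewrite // exprS -IH. Qed.

Definition ps_horner f (P : {poly {mpoly K[n]}}) : mpseries n K :=
  (map_poly (@ps_of_mpoly n K) P).[f].

Lemma ps_evalE P f : ps_eval P f = ps_horner f P.
Proof.
apply: psP => m; rewrite /ps_horner horner_coef.
rewrite size_map_inj_poly ?rmorph0 //; last exact: ps_of_mpoly_inj.
by rewrite ps_sumE; apply: eq_bigr => i _; rewrite coef_map ps_exp_expr.
Qed.

Lemma ps_rootP P f : ps_root P f <-> ps_horner f P = 0.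
Proof.
rewrite -ps_evalE; split => [H|H m]; last by rewrite H ps0E.
by apply: psP => m; rewrite H ps0E.
Qed.

(* The lowest-degree homogeneous parts of two nonzero series multiply to a
   nonzero polynomial. *)
Lemma ps_mul_eq0 f g : f * g = 0 -> f = 0 \/ g = 0.
Proof.
have low h : h <> 0 -> exists2 A : {mpoly K[n]}, A != 0 &
    exists d, (forall m, (mdeg m <= d)%N -> h m = A@_m) /\
              (forall m, mdeg m <> d -> A@_m = 0).
  move=> h0; have: exists d, exists m, mdeg m == d /\ h m <> 0.
    apply: contra_notP h0 => hn; apply: psP => m; rewrite ps0E.
    by apply: contra_notP hn => hm; exists (mdeg m), m.
  move=> exd; have exd' : exists d, `[< exists m, mdeg m == d /\ h m <> 0 >].
    by case: exd => d dP; exists d; apply/asboolP.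
  case: (ex_minnP exd') => d /asboolP[m [/eqP dm hm]] dmin.
  have small k : (mdeg k < d)%N -> h k = 0.
    move=> kd; apply: contraTeq kd => /eqP hk; rewrite -leqNgt dmin //.
    by apply/asboolP; exists k.
  exists (ps_trunc d.+1 h).
    by apply/eqP => /(congr1 (mcoeff m)); rewrite mcoeff0 mcoeff_trunc ?dm.
  exists d; split=> k kd; first by rewrite mcoeff_trunc.
  case: (ltngtP (mdeg k) d) => [kd'|kd'|//].
    by rewrite mcoeff_trunc 1?ltnW // small.
  rewrite /ps_trunc raddf_sum big1 // => l _ /=.
  rewrite mcoeffZ mcoeffX; case: eqP => [lk|]; last by rewrite mulr0.
  by have := bmdeg l; rewrite lk ltnS leqNgt kd'.
move=> fg0; apply: contrapT => /not_orP[/low[A A0 [a [fA Aa]]] /low[B B0 [b [gB Bb]]]].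
have: A * B != 0 by rewrite mulf_neq0.
move/eqP; apply; apply/mpolyP => m; rewrite mcoeff0.
(* [A] and [B] are homogeneous of degrees [a] and [b], so [A * B] lives in degree [a + b], where it
   agrees with [f * g = 0]. *)
have [mE|mE] := eqVneq (mdeg m) (a + b)%N; last first.
  rewrite mcoeffM big1 // => k /eqP mk.
  case: (eqVneq (mdeg k.1) a) => [ka|/eqP/Aa->]; last by rewrite mul0r.
  rewrite Bb ?mulr0 // => kb; move: mE.
  by rewrite mk mdegD ka kb eqxx.
have := congr1 (fun f : mpseries n K => f m) fg0; rewrite ps0E => <-.
rewrite mcoeffM; apply: eq_bigr => k /eqP mk.
have dk : (mdeg k.1 + mdeg k.2 = a + b)%N by rewrite -mdegD -mk.
case: (ltngtP (mdeg k.1) a) => ka.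
- by rewrite (fA k.1) 1?ltnW // Aa ?mul0r // => e; rewrite e ltnn in ka.
- have kb : (mdeg k.2 < b)%N.
    rewrite ltnNge; apply/negP => kb.
    by have := leq_add ka kb; rewrite -ltnS ltnS addSn dk ltnn.
  by rewrite (gB k.2) 1?ltnW // Bb ?mulr0 // => e; rewrite e ltnn in kb.
- have kb : mdeg k.2 = b by move: dk; rewrite ka => /eqP; rewrite eqn_add2l => /eqP.
  by rewrite fA ?gB ?ka ?kb.
Qed.

End SeriesRing.


(** * Factoriality of polynomial rings *)

Section Factoriality.
Variable R : idomainType.
Implicit Types a b c u : R.

Definition divides a b := exists c, b = a * c.

Definition is_prime c :=
  [/\ c != 0, c \isn't a GRing.unit
    & forall a b, divides c (a * b) -> divides c a \/ divides c b].

Definition is_irreducible c :=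
  [/\ c != 0, c \isn't a GRing.unit
    & forall a b, c = a * b -> a \is a GRing.unit \/ b \is a GRing.unit].

Inductive prime_product : R -> Prop :=
| PrimeProductUnit u of u \is a GRing.unit : prime_product u
| PrimeProductMul c a of is_prime c & prime_product a : prime_product (c * a).

(** Factorization into prime elements, rather than irreducible ones, makes uniqueness automatic and
    allows induction on the prime factors. *)
Definition factorial := forall c, c != 0 -> prime_product c.

Lemma is_prime_mulr_unit c u :
  is_prime c -> u \is a GRing.unit -> is_prime (c * u).
Proof.
case=> c0 cU cP uU; split.
- by rewrite mulf_neq0 //; apply: contraTneq uU => ->; rewrite unitr0.
- by rewrite unitrMl.
have dv a : divides (c * u) a <-> divides c a.
  split=> -[e ->]; first by exists (u * e); rewrite mulrA.
  by exists (u^-1 * e); rewrite mulrA mulrK.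
by move=> a b /dv /cP; rewrite !dv.
Qed.

End Factoriality.

(** * Gauss's lemma and irreducible polynomials over a factorial ring *)

Section PolyFactorial.
Variable R : idomainType.
Hypothesis factR : factorial R.
Implicit Types (c : R) (A B P : {poly R}).

Lemma dividesC c A : divides c%:P A <-> forall i, divides c A`_i.
Proof.
split=> [[B ->] i|H]; first by exists B`_i; rewrite coefCM.
have /choice[f fE] := H.
exists (\poly_(i < size A) f i); apply/polyP => i.
rewrite coefCM coef_poly; case: ltnP => iA; first exact: fE.
by rewrite mulr0 nth_default.
Qed.

Lemma divides_sum (S : idomainType) (I : Type) (r : seq I) (Q : pred I)
    (F : I -> S) (c : S) :
  (forall i, Q i -> divides c (F i)) -> divides c (\sum_(i <- r | Q i) F i).
Proof.
move=> H; elim/big_rec: _ => [|i x /H[a ->] [b ->]]; first by exists 0; rewrite mulr0.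
by exists (a + b); rewrite mulrDr.
Qed.

Lemma divides_add_r (S : idomainType) (c a b : S) :
  divides c (a + b) -> divides c b -> divides c a.
Proof. by move=> [d dE] [e eE]; exists (d - e); rewrite mulrBr -dE -eE addrK. Qed.

(** Let [i] and [j] be the least indices of coefficients of [A] and [B] not divisible by [c]. In
    coefficient [i + j] of [A * B], every term but [A_i * B_j] is divisible by [c]. *)
Lemma is_primeC c : is_prime c -> is_prime c%:P.
Proof.
case=> c0 cU cP; split; first by rewrite polyC_eq0.
  by rewrite poly_unitE size_polyC c0 coefC eqxx.
move=> A B cAB; apply: contrapT => /not_orP[].
have least C : ~ divides c%:P C -> exists i, ~ divides c C`_i /\
    forall j, (j < i)%N -> divides c C`_j.
  move=> /dividesC /existsNP exi.
  have exi' : exists i, `[< ~ divides c C`_i >].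
    by case: exi => i iP; exists i; apply/asboolP.
  case: (ex_minnP exi') => i /asboolP iP imin; exists i; split=> // j ji.
  by apply: contrapT => jP; have := imin j (asboolT jP); rewrite leqNgt ji.
move=> /least[i [iA jA]] /least[j [jB kB]].
have /dividesC/(_ (i + j)%N) := cAB.
have ij : (i < (i + j).+1)%N by rewrite ltnS leq_addr.
rewrite coefM (bigD1 (Ordinal ij)) //= addKn.
move=> H; have := divides_add_r H; case.
  apply: divides_sum => k ki.
  have [k_lt|k_ge] := ltnP k i.
    by have [e ->] := jA k k_lt; exists (e * B`_(i + j - k)); rewrite mulrA.
  have [|e ->] := kB (i + j - k)%N.
    rewrite ltn_subLR ?ltn_add2r; last by rewrite -ltnS.
    by rewrite ltn_neqAle k_ge andbT eq_sym.
  by exists (A`_k * e); rewrite mulrCA.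
by move=> e eE; case: (cP A`_i B`_j) => //; exists e.
Qed.

(** Induction on the prime factors of [c]: each divides [P * B] but not the primitive [P], hence
    divides [B] and cancels. *)
Lemma divides_cancel_primitive c A B P :
  c != 0 -> (forall q : R, is_prime q -> ~ divides q%:P P) ->
  c%:P * A = P * B -> divides P A.
Proof.
move=> /factR + primP; move=> cP; elim: cP B => [u uU|q a qP _ IH] B E.
  exists ((u^-1)%:P * B); rewrite mulrCA -E mulrA -polyCM mulVr // polyC1.
  by rewrite mul1r.
have [q0 _ _] := qP; case: (is_primeC qP) => qP0 _ qPP.
have [|/(primP _ qP)//|[B1 B1E]] := qPP P B.
  by exists (a%:P * A); rewrite -E polyCM mulrA.
apply: (IH B1); apply: (mulfI qP0); rewrite mulrA -polyCM E B1E.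
by rewrite mulrCA.
Qed.

(** Each prime factor of [c] stays prime in [R[X]], so it can be removed from [A] or from [B]; [e]
    collects those removed from [B]. *)
Lemma primitive_factor c P A B : c != 0 -> c%:P * P = A * B ->
  exists e A1 B1, [/\ e != 0, P = A1 * B1 & B = e%:P * B1].
Proof.
move=> /factR cP; elim: cP A B => [u uU|q a qP _ IH] A B E.
  exists 1, ((u^-1)%:P * A), B; rewrite oner_neq0 polyC1 mul1r; split=> //.
  by rewrite -mulrA -E mulrA -polyCM mulVr // polyC1 mul1r.
have [q0 _ _] := qP; case: (is_primeC qP) => qP0 _ qPP.
have E' : q%:P * (a%:P * P) = A * B by rewrite mulrA -polyCM.
have [|[A1 A1E]|[B1 B1E]] := qPP A B; first by exists (a%:P * P).
  by apply: (IH A1 B); apply: (mulfI qP0); rewrite E' A1E mulrA.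
have [|e [A2 [B2 [e0 PE BE]]]] := IH A B1.
  by apply: (mulfI qP0); rewrite E' B1E mulrCA.
by exists (q * e), A2, B2; rewrite mulf_neq0 // PE B1E BE polyCM mulrA.
Qed.

(** A constant [P] is treated in [R]. Otherwise [P] is primitive, and a nonzero [G] of least size in
    the ideal [(P, A)] divides [P] and [A] up to constants. Removing constants from [G] leaves a
    divisor [G1] of [P]: if it is associate to [P], then [P] divides [A]; if it is a unit, then [G]
    is constant and [G * B], in the ideal [(P, A * B)], is a multiple of [P]. *)
Lemma poly_irreducible_prime P : is_irreducible P -> is_prime P.
Proof.
case=> P0 PU PI.
have [sP|sP] := leqP (size P) 1.
  have [c cE] : exists c, P = c%:P by exists P`_0; apply: size1_polyC.
  have c0 : c != 0 by rewrite -polyC_eq0 -cE.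
  case: (factR c0) (c0) cE => [u uU u0 cE|q a qP _ _ cE].
    by move: PU; rewrite cE poly_unitE size_polyC u0 coefC eqxx uU.
  have qP' := is_primeC qP; rewrite polyCM in cE.
  have [/negP|aU] := PI _ _ cE; last by rewrite cE; apply: is_prime_mulr_unit.
  by case: qP' => _ /negP.
have primP (q : R) : is_prime q -> ~ divides q%:P P.
  move=> qP [B BE]; have [_ qU _] := is_primeC qP; have [q0 _ _] := qP.
  case: (PI _ _ BE) => [qU'|]; first by rewrite qU' in qU.
  rewrite poly_unitE => /andP[/eqP sB _].
  by move: sP; rewrite BE mul_polyC size_scale ?sB.
split=> // A B PAB; apply: contrapT => /not_orP[PA PB]; apply: PA.
pose inI G := exists U V, G = U * P + V * A.
have ex_s : exists s, `[< exists G, [/\ G != 0, inI G & size G = s] >].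
  exists (size P); apply/asboolP; exists P; split=> //.
  by exists 1, 0; rewrite mul1r mul0r addr0.
case: (ex_minnP ex_s) => s /asboolP[G [G0 [U [V GE]] sG]] smin.
have redG H : inI H -> exists c D, c != 0 /\ c%:P * H = D * G.
  move=> [U' [V' HE]].
  exists (lead_coef G ^+ scalp H G), (H %/ G); split.
    by rewrite expf_neq0 // lead_coef_eq0.
  rewrite mul_polyC Pdiv.Idomain.divp_eq.
  (* The pseudo-remainder lies in the ideal and is smaller than [G], so it vanishes. *)
  have [->|m0] := eqVneq (H %% G) 0; first by rewrite addr0.
  have := Pdiv.Idomain.ltn_modpN0 H G0; rewrite sG ltnNge smin //.
  apply/asboolP; exists (H %% G); split=> //.
  exists ((lead_coef G ^+ scalp H G)%:P * U' - H %/ G * U).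
  exists ((lead_coef G ^+ scalp H G)%:P * V' - H %/ G * V).
  have /eqP := Pdiv.Idomain.divp_eq H G.
  rewrite addrC -subr_eq => /eqP <-; rewrite -mul_polyC.
  by move: (_ ^+ _)%:P (H %/ G) => C D; rewrite HE GE; ring.
have [|c [D [c0 cE]]] := redG P; first by exists 1, 0; rewrite mul1r mul0r addr0.
have [|c' [D' [c'0 c'E]]] := redG A; first by exists 0, 1; rewrite mul1r mul0r add0r.
have [e [D1 [G1 [e0 PE G1E]]]] := primitive_factor c0 cE.
case: (PI _ _ PE) => [D1U|G1U].
  apply: (@divides_cancel_primitive c' A (D' * e%:P * D1^-1) P) => //.
  rewrite c'E G1E PE -[LHS]mulr1 -(mulrV D1U).
  by move: D1^-1 => X; ring.
case: PB; have [C CE] := PAB.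
move: G1U; rewrite poly_unitE => /andP[/eqP sG1 g1U].
have [g gE] : exists g, G1 = g%:P by exists G1`_0; apply: size1_polyC; rewrite sG1.
apply: (@divides_cancel_primitive (e * g) B (U * B + V * C) P) => //.
  by rewrite mulf_neq0 // -polyC_eq0 -gE -size_poly_eq0 sG1.
rewrite polyCM -gE -G1E GE mulrDl mulrDr -[V * A * B]mulrA CE.
by rewrite [U * P]mulrC -!mulrA [P * (V * C)]mulrCA.
Qed.

End PolyFactorial.

Lemma is_irreducible_iso (R S : idomainType) (f : {rmorphism R -> S}) (g : S -> R) c :
  cancel f g -> cancel g f -> is_irreducible c -> is_irreducible (f c).
Proof.
move=> fK gK [c0 cU cI].
have unitf x : (f x \is a GRing.unit) = (x \is a GRing.unit).
  apply/idP/idP => [/unitrP[y [yx xy]]|]; last exact: rmorph_unit.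
  apply/unitrP; exists (g y); split; apply: (can_inj fK);
    by rewrite rmorphM gK rmorph1.
split; first by apply: contraNneq c0 => fc0; rewrite -(fK c) fc0 -(rmorph0 f) fK.
  by rewrite unitf.
move=> a b E; have := cI (g a) (g b).
rewrite -!unitf !gK; apply; apply: (can_inj fK).
by rewrite E rmorphM !gK.
Qed.

Lemma is_prime_iso (R S : idomainType) (f : {rmorphism R -> S}) (g : S -> R) c :
  cancel f g -> cancel g f -> is_prime (f c) -> is_prime c.
Proof.
move=> fK gK [c0 cU cP].
have dv a : divides (f c) (f a) -> divides c a.
  by move=> [e eE]; exists (g e); apply: (can_inj fK); rewrite rmorphM gK.
split; first by apply: contraNneq c0 => ->; rewrite rmorph0.
  by apply: contra cU; apply: rmorph_unit.
move=> a b [e eE]; case: (cP (f a) (f b)) => [|/dv|/dv]; [|by left|by right].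
by exists (f e); rewrite -!rmorphM eE.
Qed.

(** * Factoriality of the ring of polynomials in n variables *)

Section MultiFactorial.
Variable K : fieldType.

Lemma mpoly_unit_msize n (A : {mpoly K[n]}) : (A \is a GRing.unit) = (msize A == 1%N).
Proof.
apply/idP/msize_poly1P => [/andP[/eqP AE AU]|[c c0 ->]].
  by exists A@_0; rewrite -?unitfE.
by apply/andP; rewrite mcoeffC eqxx mulr1 unitfE.
Qed.

(** Induction on the total degree: both factors of a proper factorization have smaller degree, since
    the nonzero constants are units. *)
Lemma mpoly_factorial n :
  (forall A : {mpoly K[n]}, is_irreducible A -> is_prime A) -> factorial {mpoly K[n]}.
Proof.
move=> IP A; have [k] := ubnP (msize A); elim: k A => // k IH A Ak A0.
have [AU|AU] := boolP (A \is a GRing.unit); first exact: PrimeProductUnit.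
have [AI|AnI] := pselect (is_irreducible A).
  rewrite -[A]mulr1; apply: PrimeProductMul (IP _ AI) (PrimeProductUnit (unitr1 _)).
have : exists B C, A = B * C /\ B \isn't a GRing.unit /\ C \isn't a GRing.unit.
  apply: contra_notP AnI => AnI; split=> // B C E; apply: contrapT => /not_orP[BU CU].
  by apply: AnI; exists B, C; split=> //; split; apply/negP.
move=> [B [C [E [BU CU]]]].
have B0 : B != 0 by apply: contraNneq A0 => B0; rewrite E B0 mul0r.
have C0 : C != 0 by apply: contraNneq A0 => C0; rewrite E C0 mulr0.
have gt1 (D : {mpoly K[n]}) : D != 0 -> D \isn't a GRing.unit -> (1 < msize D)%N.
  by rewrite mpoly_unit_msize -msize_poly_eq0; case: (msize D) => [|[]].
have sE : msize A = (msize B + msize C).-1 by rewrite E msizeM.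
have := gt1 _ B0 BU; have := gt1 _ C0 CU; move=> C1 B1.
have [Bk Ck] : (msize B < k)%N /\ (msize C < k)%N.
  by move: Ak B1 C1; rewrite sE; move: (msize B) (msize C) => b c *; lia.
have PB := IH _ Bk B0; have PC := IH _ Ck C0.
rewrite {}E; elim: PB => [u uU|p b pP _ IHb]; last first.
  by rewrite -mulrA; apply: PrimeProductMul.
case: PC => [v vU|p c pP pc]; first by apply: PrimeProductUnit; rewrite unitrMl.
by rewrite mulrA [u * p]mulrC; apply: PrimeProductMul => //; apply: is_prime_mulr_unit.
Qed.

(** Inverse of [muni]; the isomorphism singles out the last variable, for the induction on [n] in
    [factorial_mpoly]. *)
Definition mpoly_of_poly n (P : {poly {mpoly K[n]}}) : {mpoly K[n.+1]} :=
  (map_poly (@mwiden n K) P).['X_ord_max].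

Lemma muni_mpolyX n (m : 'X_{1..n.+1}) : muni ('X_[m] : {mpoly K[n.+1]}) =
  'X_[[multinom m (widen_ord (leqnSn n) i) | i < n]] *: 'X^(m ord_max).
Proof. by rewrite muniE msuppX big_seq1 mcoeffX eqxx scale1r. Qed.

Lemma muniK n : cancel (@muni n K) (@mpoly_of_poly n).
Proof.
move=> A; rewrite [RHS]mpolyE {1}[A]mpolyE /mpoly_of_poly (raddf_sum (@muni n K)) /=.
rewrite rmorph_sum /= horner_sum; apply: eq_bigr => m _.
rewrite muniZ muni_mpolyX !map_polyZ /= map_polyXn !hornerZ hornerXn.
rewrite mwidenC mul_mpolyC; congr (_ *: _).
rewrite mwidenX mpolyXn -mpolyXD; congr 'X_[_]; apply/mnmP => i.
rewrite mnmDE mulmnE mnm1E.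
have [->|im] := eqVneq i ord_max.
  by rewrite mnmwiden_ordmax mul1n.
have im' : (i < n)%N.
  by rewrite ltn_neqAle -ltnS ltn_ord andbT; apply: contraNneq im => e; apply/eqP/val_inj.
have -> : i = widen_ord (leqnSn n) (Ordinal im') by apply: val_inj.
by rewrite mnmwiden_widen mnmE mul0n addn0.
Qed.

Lemma muni_mwiden n (A : {mpoly K[n]}) : muni (mwiden A) = A%:P.
Proof.
rewrite [in RHS](mpolyE A) {1}[A]mpolyE (raddf_sum (@mwiden n K)) (raddf_sum (@muni n K)).
rewrite (raddf_sum (@polyC _)); apply: eq_bigr => m _ /=.
rewrite mwidenZ muniZ mwidenX muni_mpolyX mnmwiden_ordmax expr0 -!mul_polyC mulr1.
rewrite -polyCM mul_mpolyC; congr (_ *: 'X_[_])%:P.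
by apply/mnmP => i; rewrite mnmE mnmwiden_widen.
Qed.

Lemma mpoly_of_polyK n : cancel (@mpoly_of_poly n) (@muni n K).
Proof.
move=> P; rewrite /mpoly_of_poly horner_coef (raddf_sum (@muni n K)) /=.
rewrite size_map_inj_poly ?raddf0 //; last exact: inj_mwiden.
rewrite -[RHS]coefK poly_def; apply: eq_bigr => i _.
rewrite coef_map muniM muni_mwiden rmorphXn /= muni_mpolyX mul_polyC.
rewrite mnm1E eqxx expr1 (_ : [multinom _ | i < n] = 0%MM) ?mpolyX0 ?scale1r //.
apply/mnmP => j; rewrite mnmE mnm0E mnm1E; case: eqP => // /(congr1 val) /= e.
by have := ltn_ord j; rewrite -e ltnn.
Qed.

Lemma factorial_mpoly n : factorial {mpoly K[n]}.
Proof.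
elim: n => [|n IH].
  move=> A A0; apply: PrimeProductUnit; rewrite mpoly_unit_msize.
  apply/msize_poly1P; exists A@_0.
    apply: contraNneq A0 => A00; apply/eqP/mpolyP => m.
    by rewrite mcoeff0 -[RHS]A00; congr (_@_ _); apply/mnmP; case.
  apply/mpolyP => m; rewrite mcoeffC.
  have -> : m = 0%MM by apply/mnmP; case.
  by rewrite eqxx mulr1.
apply: mpoly_factorial => A AI.
apply: (is_prime_iso (@muniK n) (@mpoly_of_polyK n)).
apply: poly_irreducible_prime => //.
exact: is_irreducible_iso (@muniK n) (@mpoly_of_polyK n) AI.
Qed.

End MultiFactorial.

(** * Annihilating polynomials of bounded degree and height *)

Section Annihilators.
Variables (n : nat) (K : fieldType).
Implicit Types (A B : {mpoly K[n]}) (P Q : {poly {mpoly K[n]}}) (f : mpseries n K).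

Lemma msize_sum_le (I : Type) (r : seq I) (q : pred I) (F : I -> {mpoly K[n]}) s :
  (forall i, q i -> (msize (F i) <= s)%N) -> (msize (\sum_(i <- r | q i) F i) <= s)%N.
Proof.
move=> H; elim/big_rec: _ => [|i x /H Fs xs]; first by rewrite msize0.
by apply: leq_trans (msizeD_le _ _) _; rewrite geq_max Fs.
Qed.

Lemma pheight_leP P h : reflect (forall i, (msize P`_i <= h.+1)%N) (pheight P <= h)%N.
Proof.
apply: (iffP (@bigmax_leqP _ predT h (fun i : 'I_(size P) => (msize P`_i).-1)))
  => [H i|H i _]; last by have := H i; case: (msize _).
have [iP|iP] := ltnP i (size P); last by rewrite nth_default // msize0.
by have := H (Ordinal iP) isT => /=; case: (msize _).
Qed.

(** The last coefficient of maximal total degree: it acts as a leading term with respect to the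
    height. *)
Lemma top_coef P : P != 0 -> exists i, [/\ P`_i != 0,
  forall j, (msize P`_j <= msize P`_i)%N &
  forall j, (i < j)%N -> (msize P`_j < msize P`_i)%N].
Proof.
move=> P0; pose M := \max_(i < size P) msize P`_i.
have leM j : (msize P`_j <= M)%N.
  have [jP|jP] := ltnP j (size P); last by rewrite nth_default // msize0.
  exact: (leq_bigmax (Ordinal jP)).
have M0 : (0 < M)%N.
  apply: leq_trans (leM (size P).-1); rewrite lt0n msize_poly_eq0.
  by rewrite -lead_coefE lead_coef_eq0.
have exi : exists i, msize P`_i == M.
  have [|i iE] := @eq_bigmax _ (fun i : 'I_(size P) => msize P`_i).
    by rewrite card_ord lt0n size_poly_eq0.
  by exists i; rewrite /M iE.
have bdi i : msize P`_i == M -> (i <= size P)%N.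
  move=> /eqP iM; apply: contraTT M0; rewrite -ltnNge -iM => /ltnW Pi.
  by rewrite nth_default // msize0.
case: (ex_maxnP exi bdi) => i /eqP iM imax; exists i; split.
- by rewrite -msize_poly_eq0 iM -lt0n.
- by move=> j; rewrite iM.
move=> j ij; rewrite iM ltn_neqAle leM andbT.
by apply: contraTN ij => /imax; rewrite leqNgt.
Qed.

Lemma pheight_top P i : (forall j, (msize P`_j <= msize P`_i)%N) ->
  pheight P = (msize P`_i).-1.
Proof.
move=> iP; apply/eqP; rewrite eqn_leq; apply/andP; split.
  by apply/pheight_leP => j; apply: leq_trans (iP j) (leqSpred _).
have /pheight_leP/(_ i) := leqnn (pheight P).
by case: (msize _).
Qed.

(** With [i] and [j] from [top_coef], the term [P_i * Q_j] has larger total degree than all the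
    other terms of coefficient [i + j] of the product, so it is not cancelled. *)
Lemma pheight_mulr P Q : P != 0 -> Q != 0 -> (pheight P <= pheight (P * Q))%N.
Proof.
move=> /top_coef[i [Pi0 Pi Pi']] /top_coef[j [Qj0 Qj Qj']].
have sPi : (0 < msize P`_i)%N by rewrite lt0n msize_poly_eq0.
have sQj : (0 < msize Q`_j)%N by rewrite lt0n msize_poly_eq0.
rewrite (pheight_top Pi).
have /pheight_leP/(_ (i + j)%N) := leqnn (pheight (P * Q)).
have ij : (i < (i + j).+1)%N by rewrite ltnS leq_addr.
rewrite coefM (bigD1 (Ordinal ij)) //= addKn; set S := \sum_(_ < _ | _) _.
have Ss : (msize S <= (msize P`_i + msize Q`_j).-2)%N.
  apply: msize_sum_le => k ki.
  have [Pk0|Pk0] := eqVneq P`_k 0; first by rewrite Pk0 mul0r msize0.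
  have [Qk0|Qk0] := eqVneq Q`_(i + j - k) 0; first by rewrite Qk0 mulr0 msize0.
  rewrite msizeM //.
  have [k_lt|k_ge] := ltnP k i.
    have /Qj' : (j < i + j - k)%N by rewrite ltn_subRL ltn_add2r.
    have := Pi k; move: (msize _) (msize _) (msize _) (msize _) sPi sQj => a b c e *; lia.
  have /Pi' : (i < k)%N by rewrite ltn_neqAle k_ge andbT eq_sym.
  have := Qj (i + j - k)%N.
  by move: (msize _) (msize _) (msize _) (msize _) sPi sQj => a b c e *; lia.
have le_max : (msize (P`_i * Q`_j) <= maxn (msize (P`_i * Q`_j + S)) (msize S))%N.
  by rewrite -{1}[P`_i * _](addrK S) -(mmeasureN mdeg S); apply: msizeD_le.
move: le_max Ss; rewrite msizeM //.
by move: (msize _) (msize S) (msize _) (msize _) sPi sQj (pheight _) => a b c e *; lia.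
Qed.

Lemma pheight_mul P Q : (pheight (P * Q) <= pheight P + pheight Q)%N.
Proof.
apply/pheight_leP => i; rewrite coefM; apply: msize_sum_le => j _.
have /pheight_leP/(_ j) := leqnn (pheight P).
have /pheight_leP/(_ (i - j)%N) := leqnn (pheight Q).
have [Pk0|Pk0] := eqVneq P`_j 0; first by rewrite Pk0 mul0r msize0.
have [Qk0|Qk0] := eqVneq Q`_(i - j) 0; first by rewrite Qk0 mulr0 msize0.
rewrite msizeM //; move: (msize _) (msize _) (pheight _) (pheight _) => a b c e *; lia.
Qed.

Lemma pheight_exp P k : (pheight (P ^+ k) <= k * pheight P)%N.
Proof.
elim: k => [|k IH].
  rewrite expr0; apply/pheight_leP => i; rewrite coef1.
  by case: eqP; rewrite ?msize1 ?msize0.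
by rewrite exprS mulSn; apply: leq_trans (pheight_mul _ _) _; rewrite leq_add2l.
Qed.

Lemma ps_hornerM f : {morph ps_horner f : P Q / P * Q}.
Proof. by move=> P Q; rewrite /ps_horner rmorphM hornerM. Qed.

Lemma ps_hornerD f : {morph ps_horner f : P Q / P + Q}.
Proof. by move=> P Q; rewrite /ps_horner rmorphD hornerD. Qed.

Lemma ps_hornerC f A : ps_horner f A%:P = ps_of_mpoly A.
Proof. by rewrite /ps_horner map_polyC hornerC. Qed.

(** The degree and the height of a series may be attained by different polynomials [P1] and [P2];
    this merges the two bounds. *)
Lemma minimal_annihilator P1 P2 f : P1 != 0 -> ps_root P1 f ->
  P2 != 0 -> ps_root P2 f ->
  exists P, [/\ P != 0, ps_root P f, (size P <= size P1)%N
    & (pheight P <= pheight P2)%N].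
Proof.
move=> P10 /ps_rootP P1f P20 /ps_rootP P2f.
pose ann s P := [/\ P != 0, ps_horner f P = 0 & size P = s].
have exs : exists s, `[< exists P, ann s P >].
  by exists (size P1); apply/asboolP; exists P1.
case: (ex_minnP exs) => s /asboolP[P3 P3s] smin.
have {}smin Q : Q != 0 -> ps_horner f Q = 0 -> (s <= size Q)%N.
  by move=> Q0 Qf; apply: smin; apply/asboolP; exists Q.
have exh : exists h, `[< exists P, ann s P /\ pheight P = h >].
  by exists (pheight P3); apply/asboolP; exists P3.
case: (ex_minnP exh) => h /asboolP[P [[P0 Pf Ps] Ph]] hmin.
exists P; split=> //; first exact/ps_rootP.
  by rewrite Ps smin.
have ps_of_mpoly_neq0 A : A != 0 -> ps_of_mpoly A <> 0.
  by move=> A0 iA; case/eqP: A0; apply: (@ps_of_mpoly_inj n K); rewrite iA rmorph0.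
have [|||D DE] := @divides_cancel_primitive _ (@factorial_mpoly K n)
    (lead_coef P ^+ scalp P2 P) P2 (P2 %/ P) P.
- by rewrite expf_neq0 // lead_coef_eq0.
(* A prime dividing all coefficients of [P] could be removed, leaving an annihilator of the same
   size and smaller height. *)
- move=> q [q0 qU _] [B BE].
  have B0 : B != 0 by apply: contraNneq P0 => B0; rewrite BE B0 mulr0.
  have Bf : ps_horner f B = 0.
    by move: Pf; rewrite BE ps_hornerM ps_hornerC => /ps_mul_eq0[/(ps_of_mpoly_neq0 _ q0)|].
  have [i [Bi0 Bi _]] := top_coef B0.
  have : (h <= pheight B)%N.
    apply: hmin; apply/asboolP; exists B; split=> //; split=> //.
    by rewrite -Ps BE mul_polyC size_scale.
  rewrite leqNgt => /negP; apply; rewrite (pheight_top Bi).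
  have /pheight_leP/(_ i) := leqnn (pheight P).
  rewrite Ph BE coefCM msizeM //.
  move: qU q0 Bi0; rewrite mpoly_unit_msize -!msize_poly_eq0.
  by move: (msize q) (msize B`_i) => a b *; lia.
(* The pseudo-remainder of [P2] by [P] annihilates [f] and is smaller than [P], so it is zero. *)
- rewrite mul_polyC Pdiv.Idomain.divp_eq.
  have [->|m0] := eqVneq (P2 %% P) 0; first by rewrite addr0 mulrC.
  have := Pdiv.Idomain.ltn_modpN0 P2 P0; rewrite Ps ltnNge smin //.
  have := congr1 (ps_horner f) (Pdiv.Idomain.divp_eq P2 P).
  rewrite -mul_polyC ps_hornerD !ps_hornerM P2f Pf !mulr0 add0r; exact: esym.
rewrite DE pheight_mulr //; apply: contraNneq P20 => D0.
by rewrite DE D0 mulr0.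
Qed.

End Annihilators.

(** * Reduction to a separable equation *)

Section Separable.
Variables (n : nat) (K : fieldType) (p : nat).
Hypothesis charK : p \in [pchar K].
Implicit Types (P Q : {poly {mpoly K[n]}}) (f : mpseries n K).

Lemma msizeMn_le (A : {mpoly K[n]}) i : (msize (A *+ i) <= msize A)%N.
Proof. by rewrite -scaler_nat; apply: mmeasureZ_le. Qed.

Lemma pheight_deriv P : (pheight P^`() <= pheight P)%N.
Proof.
apply/pheight_leP => i; rewrite coef_deriv; apply: leq_trans (msizeMn_le _ _) _.
exact: (pheight_leP _ _ (leqnn (pheight P))).
Qed.

(** Induction on the degree bound: if [P'(f) = 0], pass to [P'] when it is nonzero, and otherwise to
    [Q] with [P(Y) = Q(Y^p)]. Only the second move raises [k]. *)
Lemma separable_annihilator d P f :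
  P != 0 -> ps_horner f P = 0 -> (size P <= d.+1)%N ->
  exists k Q, [/\ (k <= d)%N, ps_horner (f ^+ (p ^ k)) Q = 0,
    ps_horner (f ^+ (p ^ k)) Q^`() != 0, (size Q <= d.+1)%N
    & (pheight Q <= pheight P)%N].
Proof.
have p_gt1 := prime_gt1 (pcharf_prime charK).
elim: d P f => [|d IH] P f P0 Pf sP.
  have [c cE] : exists c, P = c%:P by exists P`_0; apply: size1_polyC.
  move: P0 Pf; rewrite cE ps_hornerC polyC_eq0 => c0 ic.
  by case/eqP: c0; apply: (@ps_of_mpoly_inj n K); rewrite ic rmorph0.
have [Df|] := eqVneq (ps_horner f P^`()) 0; last first.
  by move=> Df; exists 0%N, P; rewrite expn0 expr1.
have [D0|D0] := eqVneq P^`() 0; last first.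
  have [|k [Q [kd Qf DQf sQ hQ]]] := IH _ _ D0 Df.
    by rewrite -ltnS; apply: leq_trans sP; apply: lt_size_deriv.
  exists k, Q; split=> //; [exact: leqW|exact: leqW|].
  exact: leq_trans hQ (pheight_deriv P).
(* No coefficient is lost: for [j > d] one has [j * p >= 2 * (d + 1) >= size P]. *)
pose Q := \poly_(j < d.+1) P`_(j * p).
have coefQ j : Q`_j = P`_(j * p).
  rewrite coef_poly; case: ltnP => // dj; rewrite nth_default //.
  apply: leq_trans sP _; apply: leq_trans (leq_mul dj p_gt1).
  by rewrite muln2 -addnn addnS addSn ltnS leq_addr.
have PQ : P = Q \Po 'X^p.
  apply/polyP => i; rewrite coef_comp_poly_Xn ?prime_gt0 ?(pcharf_prime charK) //.
  case: ifP => [/divnK ip|pi]; first by rewrite coefQ ip.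
  case: i pi => [|i] pi; first by rewrite dvdn0 in pi.
  have := congr1 (fun P : {poly _} => P`_i) D0.
  rewrite coef_deriv coef0 -scaler_nat => /eqP.
  rewrite mscalerI -(dvdn_pcharf charK) pi /=.
  by move/eqP.
have Q0 : Q != 0 by apply: contraNneq P0 => Q0; rewrite PQ Q0 comp_poly0.
have Qf : ps_horner (f ^+ p) Q = 0.
  by rewrite -Pf [in RHS]PQ /ps_horner map_comp_poly horner_comp map_polyXn hornerXn.
have [k [Q' [kd Qf' DQf' sQ' hQ']]] := IH _ _ Q0 Qf (size_poly _ _).
exists k.+1, Q'; rewrite expnS exprM; split=> //; first exact: leqW.
apply: leq_trans hQ' _; apply/pheight_leP => j; rewrite coefQ.
exact: (pheight_leP _ _ (leqnn (pheight P))).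
Qed.

End Separable.

(** * Sections of power series *)

Section MonomialShift.
Variables (n : nat) (K : fieldType).
Implicit Types (f : mpseries n K) (A : {mpoly K[n]}) (m k : 'X_{1..n}).

Lemma mcoeff_XM A k m :
  ('X_[k] * A)@_m = if (k <= m)%MM then A@_(m - k) else 0.
Proof.
case: ifP => [km|km]; first by rewrite mulrC -{1}(submK km) addmC mcoeffMX.
rewrite mcoeffM big1 // => l /eqP ml; rewrite mcoeffX.
case: eqP => [kl|]; last by rewrite mul0r.
by move: km; rewrite kl => /negP[]; have := lem_addr l.1 l.2; rewrite -ml.
Qed.

Lemma ps_mulXE f k m :
  (ps_of_mpoly 'X_[k] * f) m = if (k <= m)%MM then f (m - k)%MM else 0.
Proof.
rewrite [LHS](@ps_mul_mcoeff _ _ _ _ 'X_[k] (ps_trunc (mdeg m).+1 f)) //; last first.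
  by move=> l lm; rewrite mcoeff_trunc.
rewrite mcoeff_XM; case: ifP => // km; rewrite mcoeff_trunc // ltnS.
exact: mdegB.
Qed.

Lemma ps_mulCE f c m : (ps_of_mpoly c%:MP * f) m = c * f m.
Proof.
rewrite [LHS](@ps_mul_mcoeff _ _ _ _ c%:MP (ps_trunc (mdeg m).+1 f)) //; last first.
  by move=> l lm; rewrite mcoeff_trunc.
by rewrite mcoeffCM mcoeff_trunc.
Qed.

Lemma ps_mulZXE f c k m :
  (ps_of_mpoly (c *: 'X_[k]) * f) m = if (k <= m)%MM then c * f (m - k)%MM else 0.
Proof.
rewrite -mul_mpolyC rmorphM -mulrA ps_mulCE ps_mulXE.
by case: ifP => // _; rewrite mulr0.
Qed.

Lemma ps_mul_low (f g : mpseries n K) N m :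
  (forall k, (mdeg k < N)%N -> f k = 0) -> (mdeg m < N)%N -> (f * g) m = 0.
Proof.
move=> fN mN; rewrite [LHS](@ps_mul_mcoeff _ _ _ _ 0 (ps_trunc (mdeg m).+1 g)).
- by rewrite mul0r mcoeff0.
- by move=> k km; rewrite mcoeff0 fN // (leq_ltn_trans km).
by move=> k km; rewrite mcoeff_trunc.
Qed.

Lemma ps_mul_truncE (f g : mpseries n K) N m : (mdeg m < N)%N ->
  (f * g) m = (ps_of_mpoly (ps_trunc N f) * g) m.
Proof.
move=> mN; apply/eqP; rewrite -subr_eq0; apply/eqP.
transitivity (((f - ps_of_mpoly (ps_trunc N f)) * g) m); first by rewrite mulrBl.
apply: ps_mul_low mN => k kN.
by rewrite [LHS](_ : _ = f k - (ps_trunc N f)@_k) // mcoeff_trunc // subrr.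
Qed.

End MonomialShift.

Definition const_mnm n i : 'X_{1..n} := [multinom i | _ < n].

Lemma const_mnmE n i j : const_mnm n i j = i.
Proof. exact: mnmE. Qed.

Section Sections.
Variables (n : nat) (K : fieldType) (q : nat).
Hypothesis charq : [pchar K].-nat q.
Implicit Types (f g : mpseries n K) (A : {mpoly K[n]}) (m k : 'X_{1..n}).

Definition ps_section i f : mpseries n K := fun m => f (m *+ q + const_mnm n i)%MM.
Definition ps_frob f : mpseries n K := fun m => f m ^+ q.

Fact ps_section_is_zmod_morphism i : zmod_morphism (ps_section i).
Proof. by []. Qed.
HB.instance Definition _ i :=
  GRing.isZmodMorphism.Build (mpseries n K) (mpseries n K) (ps_section i)
    (ps_section_is_zmod_morphism i).


Lemma pnat_gt0 : (0 < q)%N.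
Proof. by case/andP: charq. Qed.
Let q_gt0 := pnat_gt0.

Lemma mpoly_pcharn : [pchar {mpoly K[n]}].-nat q.
Proof.
by apply: sub_in_pnat charq => l _; apply: (rmorph_pchar (@mpolyC n K)).
Qed.

Lemma ps_pcharn : [pchar (mpseries n K)].-nat q.
Proof.
by apply: sub_in_pnat mpoly_pcharn => l _; apply: (rmorph_pchar (@ps_of_mpoly n K)).
Qed.

(** In characteristic dividing [q], [f ^+ q] is [ps_frob q f] with every variable raised to the
    power [q], so it passes through the section. The condition [i < q] makes [k q <= m q + i]
    equivalent to [k <= m]. *)
Lemma ps_section_expM i f g : (i < q)%N ->
  ps_section i (f ^+ q * g) = ps_frob f * ps_section i g.
Proof.
move=> iq; apply: psP => m; rewrite /ps_section.
set M := (m *+ q + _)%MM; pose N := (mdeg M).+1; pose T := ps_trunc N f.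
have mN : (mdeg m < N)%N.
  by rewrite ltnS mdegD mdegMn (leq_trans (leq_pmulr _ q_gt0)) ?leq_addr.
have MN : (mdeg M < N)%N by [].
(* The error is [(f - T) ^+ q * g], and [f - T] has no coefficient of degree below [N]. *)
have -> : (f ^+ q * g) M = (ps_of_mpoly (T ^+ q) * g) M.
  rewrite -{1}[f](subrK (ps_of_mpoly T)) exprDn_pchar; last exact: ps_pcharn.
  rewrite mulrDl psDE rmorphXn [X in X + _](_ : _ = 0) ?add0r //.
  rewrite -(prednK q_gt0) exprS -mulrA; apply: ps_mul_low MN => k kN.
  by rewrite [LHS](_ : _ = f k - T@_k) // mcoeff_trunc // subrr.
have -> : T ^+ q = \sum_(k : 'X_{1..n < N}) f k ^+ q *: 'X_[k *+ q].
  rewrite /T /ps_trunc.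
  rewrite (big_morph (fun x : {mpoly K[n]} => x ^+ q) (id1 := 0) (op1 := +%R)).
  - by apply: eq_bigr => k _; rewrite exprZn mpolyXn.
  - by move=> x y; rewrite exprDn_pchar //; apply: mpoly_pcharn.
  by rewrite expr0n eqn0Ngt q_gt0.
rewrite (ps_mul_truncE _ _ mN) /ps_trunc !rmorph_sum !mulr_suml !ps_sumE.
apply: eq_bigr => k _; rewrite !ps_mulZXE.
have -> : (k *+ q <= M)%MM = (k <= m)%MM.
  apply/mnm_lepP/mnm_lepP => H j; have := H j; rewrite mulmnE mnmDE mulmnE const_mnmE.
    rewrite -[(_ * q <= _)%N]ltnS -addnS => H'; rewrite -ltnS -(ltn_pmul2r q_gt0).
    by apply: leq_trans H' _; rewrite mulSn addnC leq_add2r.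
  by move=> kj; apply: leq_trans (leq_addr _ _); rewrite leq_mul2r kj orbT.
case: ifP => // km; congr (_ * g _); apply/mnmP => j.
have kj : (k j <= m j)%N by apply/mnm_lepP.
by rewrite !(mnmDE, mnmBE, mulmnE, const_mnmE) mulnBl addnBAC // leq_mul2r kj orbT.
Qed.

End Sections.

(** * The section of residue q - 1 in one variable *)

Section PolySection.
Variables (R : comNzRingType) (q : nat).
Hypothesis charq : [pchar R].-nat q.
Implicit Types (U V W : {poly R}) (a c : R).

Let q_gt0 : (0 < q)%N.
Proof. by case/andP: charq. Qed.

Definition poly_section U : {poly R} := \poly_(j < size U) U`_(j * q + q.-1).

Lemma coef_poly_section U j : (poly_section U)`_j = U`_(j * q + q.-1).
Proof.
rewrite coef_poly; case: ltnP => // Uj; rewrite nth_default //.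
by apply: leq_trans Uj _; apply: leq_trans (leq_pmulr _ q_gt0) (leq_addr _ _).
Qed.

Lemma poly_sectionD U V : poly_section (U + V) = poly_section U + poly_section V.
Proof. by apply/polyP => j; rewrite !(coef_poly_section, coefD). Qed.

Lemma poly_sectionCM c U : poly_section (c%:P * U) = c%:P * poly_section U.
Proof. by apply/polyP => j; rewrite !(coef_poly_section, coefCM). Qed.

Lemma poly_sectionXnM U : poly_section ('X^q * U) = 'X * poly_section U.
Proof.
apply/polyP => -[|j]; rewrite coefXM coef_poly_section coefXnM /=.
  by rewrite mul0n add0n prednK // leqnn.
rewrite coef_poly_section mulSn -addnA ltnNge leq_addr /=.
by congr (U`_ _); rewrite addKn.
Qed.

(** Write [W = V * (X - a) + W(a)]. The first term yields [(X^q - a^q) * V], whose section is a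
    multiple of [X - a^q]. The second yields [W(a)], because [(X - a)^(q-1)] is monic of degree
    [q - 1] and so has section 1. *)
Lemma poly_section_exp_XsubC a W :
  (poly_section (('X - a%:P) ^+ q.-1 * W)).[a ^+ q] = W.[a].
Proof.
have /factor_theorem[V VE] : root (W - W.[a]%:P) a by rewrite rootE !hornerE subrr.
have XaE : ('X - a%:P) ^+ q.-1 * ('X - a%:P) = 'X^q - (a ^+ q)%:P.
  have charq' : [pchar {poly R}].-nat q.
    by apply: sub_in_pnat charq => l _; apply: (rmorph_pchar (@polyC R)).
  by rewrite -exprSr prednK // exprDn_pchar // exprNn_pchar // rmorphXn.
rewrite -[in LHS](subrK W.[a]%:P W) VE mulrDr [V * _]mulrC mulrA XaE.
rewrite mulrBl -mulNr poly_sectionD poly_sectionD -polyCN !poly_sectionCM.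
rewrite poly_sectionXnM [_ * W.[a]%:P]mulrC poly_sectionCM.
rewrite !hornerE mulNr subrr add0r.
have -> : poly_section (('X - a%:P) ^+ q.-1) = 1.
  apply/polyP => j; rewrite coef_poly_section coef1.
  case: j => [|j]; rewrite ?mul0n ?add0n /=.
    have := monicP (monic_exp q.-1 (monicXsubC a)).
    by rewrite lead_coefE size_exp_XsubC.
  by rewrite nth_default // size_exp_XsubC prednK // mulSn -addnA leq_addr.
by rewrite hornerE mulr1.
Qed.

End PolySection.

(** * Sections of quotients Q(f) / P'(f) *)

Section Cartier.
Variables (n : nat) (K : fieldType) (q : nat).
Hypothesis charq : [pchar K].-nat q.
Implicit Types (P Q : {poly {mpoly K[n]}}) (f g : mpseries n K) (A : {mpoly K[n]}).

Let q_gt0 := pnat_gt0 charq.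

Definition mpoly_section i A : {mpoly K[n]} :=
  \sum_(m : 'X_{1..n < msize A}) A@_(m *+ q + const_mnm n i)%MM *: 'X_[m].

Lemma mcoeff_mpoly_section i A m :
  (mpoly_section i A)@_m = A@_(m *+ q + const_mnm n i)%MM.
Proof.
have [mA|Am] := ltnP (mdeg m) (msize A); first by
  exact: (mcoeff_mpoly (fun m => A@_(m *+ q + const_mnm n i)%MM)).
rewrite [RHS]memN_msupp_eq0; last first.
  apply: msize_mdeg_ge; apply: leq_trans Am _.
  by rewrite mdegD mdegMn; apply: leq_trans (leq_pmulr _ q_gt0) (leq_addr _ _).
rewrite /mpoly_section raddf_sum big1 // => l _ /=.
rewrite mcoeffZ mcoeffX; case: eqP => [lm|]; last by rewrite mulr0.
by have := bmdeg l; rewrite lm ltnNge Am.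
Qed.

Lemma ps_section_of_mpoly i A :
  ps_section q i (ps_of_mpoly A) = ps_of_mpoly (mpoly_section i A).
Proof. by apply: psP => m; rewrite /ps_of_mpoly mcoeff_mpoly_section. Qed.

(** A monomial [m] of the section comes from one of [A] of degree at least [q * mdeg m], and the
    bound assumed on [msize A] equals [(s + 1) * q]. *)
Lemma msize_mpoly_section i A s : (msize A <= (s * q).+1 + q.-1)%N ->
  (msize (mpoly_section i A) <= s.+1)%N.
Proof.
move=> As; rewrite msizeE; apply/bigmax_leqP_seq => m.
rewrite mcoeff_msupp mcoeff_mpoly_section => Am _; rewrite ltnS.
have : (mdeg (m *+ q + const_mnm n i) < msize A)%N.
  by rewrite ltnNge; apply: contra Am => /msize_mdeg_ge/memN_msupp_eq0->.
rewrite mdegD mdegMn => H.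
have : (mdeg m * q < s.+1 * q)%N.
  move: As H q_gt0; rewrite mulSn.
  by move: (msize A) (mdeg _) (mdeg m * q)%N (s * q)%N => a b c e *; lia.
by rewrite ltn_pmul2r.
Qed.

Definition section_coef i P Q j := mpoly_section i (Q * P ^+ q.-1)`_(j * q + q.-1).

(** Factor [P = W * (Y - f)], so that [P'(f) = W(f)]. Then [poly_section_exp_XsubC] applied to
    [Q * W^(q-1)] writes [D^q g = D^(q-1) Q(f)] as a combination of the [(f^j)^q], and
    [ps_section_expM] takes the sections of both sides. *)
Lemma ps_section_quotient (P Q : {poly {mpoly K[n]}}) f g i N : (i < q)%N ->
  ps_horner f P = 0 -> ps_horner f P^`() * g = ps_horner f Q ->
  (size (Q * P ^+ q.-1)%R <= N * q + q.-1)%N ->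
  ps_frob q (ps_horner f P^`()) * ps_section q i g =
  \sum_(j < N) ps_of_mpoly (section_coef i P Q j) * ps_frob q (f ^+ j).
Proof.
move=> iq Pf DgQ sZ; set Z := Q * _ in sZ *; set D := ps_horner f _ in DgQ *.
have charS := ps_pcharn n charq.
have /factor_theorem[W WE] : root (map_poly (@ps_of_mpoly n K) P) f by apply/eqP.
have DW : D = W.[f].
  by rewrite /D /ps_horner -deriv_map WE derivM derivXsubC !hornerE subrr mulr0 add0r.
have ZE : D ^+ q * g = \sum_(j < N) (f ^+ j) ^+ q * ps_of_mpoly Z`_(j * q + q.-1).
  transitivity (poly_section q (map_poly (@ps_of_mpoly n K) Z)).[f ^+ q].
    rewrite rmorphM rmorphXn /= WE exprMn [W ^+ _ * _]mulrC mulrCA.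
    rewrite poly_section_exp_XsubC // hornerM horner_exp -DW.
    by rewrite -[in LHS](prednK q_gt0) exprSr -mulrA DgQ mulrC.
  rewrite (@horner_coef_wide _ N); last first.
    apply/leq_sizeP => j Nj; rewrite coef_poly_section // nth_default //.
    rewrite size_map_inj_poly ?rmorph0 //; last exact: ps_of_mpoly_inj.
    by apply: leq_trans sZ _; rewrite leq_add2r leq_mul2r Nj orbT.
  apply: eq_bigr => j _; rewrite coef_poly_section // coef_map -!exprM.
  by rewrite [(q * j)%N]mulnC mulrC.
rewrite -ps_section_expM // ZE raddf_sum /=; apply: eq_bigr => j _.
by rewrite ps_section_expM // ps_section_of_mpoly mulrC.
Qed.

End Cartier.

(** * Diagonals *)

Lemma linear_dependence (K : fieldType) (I J : finType) (C : I -> J -> K) :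
  (#|J| < #|I|)%N ->
  exists2 c : I -> K, exists i, c i != 0 & forall j, \sum_i c i * C i j = 0.
Proof.
move=> JI; pose M := \matrix_(i < #|I|, j < #|J|) C (enum_val i) (enum_val j).
have : kermx M != 0.
  by rewrite kermx_eq0 /row_free neq_ltn (leq_ltn_trans (rank_leq_col M)).
case/matrix0Pn => r [s Mrs]; exists (fun i => kermx M r (enum_rank i)).
  by exists (enum_val s); rewrite enum_valK.
move=> j; have /matrixP/(_ r (enum_rank j)) := mulmx_ker M.
rewrite [LHS]mxE [RHS]mxE => H; rewrite -[RHS]H (reindex (@enum_val _ I)) /=; last first.
  by exists enum_rank => i _; rewrite (enum_valK, enum_rankK).
by apply: eq_bigr => i _; rewrite [M _ _]mxE enum_valK enum_rankK.
Qed.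

Section Diagonal.
Variables (n : nat) (K : fieldType).
Hypothesis n_gt0 : (0 < n)%N.
Implicit Types (f : mpseries n K).

Lemma const_mnm_le i j : (const_mnm n i <= const_mnm n j)%MM = (i <= j)%N.
Proof.
apply/mnm_lepP/idP => [/(_ (Ordinal n_gt0))|ij k]; by rewrite !const_mnmE.
Qed.

Lemma const_mnmB i j : (const_mnm n i - const_mnm n j)%MM = const_mnm n (i - j).
Proof. by apply/mnmP => k; rewrite mnmBE !const_mnmE. Qed.

Lemma const_mnm_divn q i : 
  const_mnm n i = (const_mnm n (i %/ q) *+ q + const_mnm n (i %% q))%MM.
Proof. by apply/mnmP => k; rewrite mnmDE mulmnE !const_mnmE -divn_eq. Qed.

(** The case [g = 1] of [ps_section_expM]: the section of 1 at the residue of [a] is 1 if [q]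
    divides [a] and 0 otherwise. *)
Lemma ps_exp_const_mnm q f a : [pchar K].-nat q ->
  (f ^+ q) (const_mnm n a) =
  if (q %| a)%N then f (const_mnm n (a %/ q)) ^+ q else 0.
Proof.
move=> charq; have q_gt0 := pnat_gt0 charq.
rewrite {1}(const_mnm_divn q a) -[f ^+ q]mulr1.
have aq : (a %% q < q)%N by rewrite ltn_mod.
have := congr1 (fun g : mpseries n K => g (const_mnm n (a %/ q)))
  (ps_section_expM charq f 1 aq).
rewrite {1}/ps_section => ->.
have E m : ps_section q (a %% q) (1 : mpseries n K) m =
    ((q %| a)%N && (m == 0%MM))%:R.
  rewrite /ps_section [LHS]mcoeff1; congr (_%:R); congr nat_of_bool.
  rewrite mnmD_eq0 andbC; congr andb.
    rewrite /dvdn; apply/eqP/eqP => [/mnmP/(_ (Ordinal n_gt0))|->].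
      by rewrite const_mnmE mnm0E.
    by apply/mnmP => k; rewrite !mnmE.
  apply/eqP/eqP => [/mnmP H|->]; apply/mnmP => k; last by rewrite mulmnE mnm0E mul0n.
  have /eqP := H k; rewrite mulmnE mnm0E muln_eq0 => /orP[/eqP //|].
  by rewrite eqn0Ngt q_gt0.
case: ifP => qa; rewrite qa in E.
  rewrite [ps_section _ _ _](_ : _ = 1) ?mulr1 //.
  by apply: psP => m; rewrite E [RHS]mcoeff1.
rewrite [ps_section _ _ _](_ : _ = 0) ?mulr0 ?ps0E //.
by apply: psP => m; rewrite E ps0E.
Qed.

End Diagonal.

Lemma mnm_ord1 (m : 'X_{1..1}) : m = const_mnm 1 (m ord0).
Proof. by apply/mnmP => i; rewrite const_mnmE ord1. Qed.

(** Diagonals do not respect products in general, but [ps_exp_const_mnm] computes both sides, once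
    in 1 and once in [n] variables. *)
Lemma diagonal_exp n (K : fieldType) q (f : mpseries n K) :
  (0 < n)%N -> [pchar K].-nat q -> diagonal f ^+ q = diagonal (f ^+ q).
Proof.
move=> n_gt0 charq; apply: psP => m; rewrite [RHS]ps_exp_const_mnm //.
rewrite [in LHS](mnm_ord1 m) ps_exp_const_mnm //.
by rewrite /diagonal -/(const_mnm n _) !const_mnmE.
Qed.

(** * A linear relation between the p-power powers of the diagonal *)

Section Relation.
Variables (n : nat) (K : fieldType) (p : nat).
Hypotheses (n_gt0 : (0 < n)%N) (charK : p \in [pchar K]).
Variables (d h : nat) (P : {poly {mpoly K[n]}}) (f : mpseries n K).
Hypotheses (Pf : ps_horner f P = 0) (Df : ps_horner f P^`() != 0)
  (sP : (size P <= d.+1)%N) (hP : (pheight P <= h)%N).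

(** The number of coefficients of a polynomial of degree at most [d] in [Y] whose coefficients have
    total degree at most [h + n]. *)
Let M := (d.+1 * #|{: 'X_{1..n < (h + n).+1}}|)%N.
Let q := (p ^ M)%N.

Let charp k : [pchar K].-nat (p ^ k)%N.
Proof. by rewrite pnatX pnatE ?(pcharf_prime charK) // charK. Qed.

Let q_gt0 : (0 < q)%N.
Proof. exact: pnat_gt0 (charp M). Qed.

Let P_neq0 : P != 0.
Proof. by apply: contraNneq Df => ->; rewrite deriv0 /ps_horner rmorph0 horner0. Qed.

(** The [Q] with [P'(f) g = Q(f)] for [g = (x_1 ... x_n)^s f^(p^k)]. *)
Definition cartier_num k s : {poly {mpoly K[n]}} :=
  ('X_[const_mnm n s])%:P * 'X^(p ^ k) * P^`().

Lemma ps_horner_cartier_num k s :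
  ps_horner f P^`() * (ps_of_mpoly 'X_[const_mnm n s] * f ^+ (p ^ k)) =
  ps_horner f (cartier_num k s).
Proof.
rewrite !ps_hornerM ps_hornerC mulrC; congr (_ * _ * _).
by rewrite /ps_horner map_polyXn hornerXn.
Qed.

(** The degree in [Y] is at most [p^k + (d - 1) + d (q - 1)], which is less than [(d + 1) q] since
    [p^k <= q]. So the section has at most [d + 1] coefficients. *)
Lemma size_cartier_num k s : (k <= M)%N ->
  (size (cartier_num k s * P ^+ q.-1)%R <= d.+1 * q + q.-1)%N.
Proof.
move=> kM; have pkq : (p ^ k <= q)%N.
  by rewrite leq_pexp2l // prime_gt0 ?(pcharf_prime charK).
have s1 : (size P^`() <= d)%N.
  by rewrite -ltnS; apply: leq_trans sP; apply: lt_size_deriv.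
have s2 : (size (P ^+ q.-1)%R <= (d * q.-1).+1)%N.
  apply: leq_trans (size_poly_exp_leq _ _) _; rewrite ltnS leq_mul2r orbC.
  by rewrite -ltnS prednK ?sP // size_poly_gt0.
pose X : {poly {mpoly K[n]}} := 'X_[const_mnm n s]%:P * 'X^(p ^ k).
have s3 : (size X <= (p ^ k).+1)%N.
  by apply: leq_trans (size_polyMleq _ _) _; rewrite size_polyC size_polyXn; case: (_ != 0).
have s4 : (size (cartier_num k s) <= p ^ k + d)%N.
  apply: leq_trans (size_polyMleq _ _) _.
  by rewrite -(leq_add2r 1) -ltnS; move: s1 s3; move: (size _) (size _) => a b *; lia.
apply: leq_trans (size_polyMleq _ _) _.
rewrite mulSn; move: s2 s4 pkq q_gt0; rewrite -subn1 mulnBr muln1.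
have : (d <= d * q)%N by rewrite leq_pmulr.
by move: (size _) (size _) (d * q)%N (p ^ k)%N => a b c e *; lia.
Qed.

(** Before the section the height is at most [n s + h + (q - 1) h <= (h + n) q]; the section divides
    it by [q], so the bound does not depend on [q]. *)
Lemma msize_section_cartier i k s j : (s < q)%N ->
  (msize (section_coef q i P (cartier_num k s) j) <= (h + n).+1)%N.
Proof.
move=> sq; apply: (msize_mpoly_section (charp M)).
pose X : {poly {mpoly K[n]}} := 'X_[const_mnm n s]%:P * 'X^(p ^ k).
have h1 : (pheight X <= n * s)%N.
  apply/pheight_leP => l; rewrite coefCM coefXn.
  case: eqP => _; last by rewrite mulr0 msize0.
  rewrite mulr1 msizeX ltnS mdegE (eq_bigr (fun=> s)) => [|? _].
    by rewrite sum_nat_const card_ord.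
  by rewrite const_mnmE.
have h2 : (pheight (cartier_num k s) <= n * s + h)%N.
  apply: leq_trans (pheight_mul _ _) _; apply: leq_add => //.
  exact: leq_trans (pheight_deriv _) hP.
have h3 : (pheight (P ^+ q.-1)%R <= q.-1 * h)%N.
  by apply: leq_trans (pheight_exp _ _) _; rewrite leq_mul2l hP orbT.
have h4 : (pheight (cartier_num k s * P ^+ q.-1)%R <= (h + n) * q)%N.
  apply: leq_trans (pheight_mul _ _) _; apply: leq_trans (leq_add h2 h3) _.
  rewrite -addnA -mulSn prednK // mulnDl addnC mulnC leq_add2l leq_mul2l.
  by rewrite ltnW ?orbT.
by apply: leq_trans (leq_addr _ _); apply: (pheight_leP _ _ h4).
Qed.

Lemma diagonal_relation : exists2 c : 'I_M.+1 * 'I_q -> K, exists x, c x != 0 &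
  \sum_x ps_of_mpoly (c x *: 'X_[const_mnm 1 x.2]) * diagonal f ^+ (p ^ x.1) = 0.
Proof.
pose D := ps_horner f P^`().
(* There are [(M + 1) q] unknowns [x] against [q M] equations [y], one for each residue and each
   coefficient of the section. *)
pose C (x : 'I_M.+1 * 'I_q) (y : 'I_q * ('I_d.+1 * 'X_{1..n < (h + n).+1})) :=
  (section_coef q y.1 P (cartier_num x.1 x.2) y.2.1)@_(y.2.2).
have [|c c_neq0 cC] := @linear_dependence K _ _ C.
  by rewrite !card_prod !card_ord -/M mulnC ltn_mul2r q_gt0 ltnSn.
exists c => //.
pose G (x : 'I_M.+1 * 'I_q) : mpseries n K :=
  ps_of_mpoly 'X_[const_mnm n x.2] * f ^+ (p ^ x.1).
pose W := \sum_x ps_of_mpoly (c x)%:MP * G x.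
have frobD0 : ps_frob q D <> 0.
  move=> fD; case/eqP: Df; apply: psP => m; rewrite ps0E.
  have /eqP := congr1 (fun g : mpseries n K => g m) fD.
  by rewrite ps0E expf_eq0 q_gt0 => /eqP.
have secW i : (i < q)%N -> ps_section q i W = 0.
  move=> iq; suff H : ps_frob q D * ps_section q i W = 0 by case: (ps_mul_eq0 H).
  rewrite /W (raddf_sum (ps_section q i)) mulr_sumr /=.
  transitivity (\sum_x \sum_(j < d.+1)
      ps_of_mpoly ((c x)%:MP * section_coef q i P (cartier_num x.1 x.2) j)
      * ps_frob q (f ^+ j)).
    apply: eq_bigr => x _.
    have -> : ps_section q i (ps_of_mpoly (c x)%:MP * G x) =
              ps_of_mpoly (c x)%:MP * ps_section q i (G x).
      by apply: psP => m; rewrite /ps_section !ps_mulCE.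
    rewrite mulrCA (ps_section_quotient (N := d.+1) (charp M) iq Pf
      (ps_horner_cartier_num _ _)).
      by rewrite mulr_sumr; apply: eq_bigr => j _; rewrite mulrA -rmorphM.
    by apply: size_cartier_num; rewrite -ltnS.
  rewrite exchange_big big1 // => j _; rewrite -mulr_suml -rmorph_sum.
  rewrite (_ : \sum_x _ = 0) ?rmorph0 ?mul0r //.
  apply/mpolyP => m; rewrite mcoeff0 raddf_sum /=.
  (* In low degree this is the choice of [c]; in higher degree every section coefficient vanishes by
     [msize_section_cartier]. *)
  have [mh|hm] := ltnP (mdeg m) (h + n).+1.
    rewrite -[RHS](cC (Ordinal iq, (j, BMultinom mh))).
    by apply: eq_bigr => x _; rewrite mcoeffCM.
  rewrite big1 // => x _; rewrite mcoeffCM memN_msupp_eq0 ?mulr0 //.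
  by apply: msize_mdeg_ge; apply: leq_trans hm; apply: msize_section_cartier.
apply: psP => m; rewrite ps0E ps_sumE.
(* A diagonal coefficient of index [a] is the one of index [a %/ q] on the diagonal of the section
   of residue [a %% q]. *)
have : W (const_mnm n (m ord0)) = 0.
  rewrite (const_mnm_divn n q).
  have /secW/(congr1 (fun g : mpseries n K => g (const_mnm n (m ord0 %/ q)))) :
    (m ord0 %% q < q)%N by rewrite ltn_mod.
  by rewrite ps0E.
rewrite /W ps_sumE => W0; rewrite -[RHS]W0; apply: eq_bigr => x _.
rewrite ps_mulZXE ps_mulCE /G ps_mulXE const_mnm_le // const_mnmB.
rewrite {1}(mnm_ord1 m) const_mnm_le // diagonal_exp //.
case: ifP => _; last by rewrite mulr0.
by rewrite {1}(mnm_ord1 m) const_mnmB /diagonal const_mnmE.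
Qed.

End Relation.

(** * Recursiveness of the exponent *)

Section Recursive.

Lemma recursive_comp2 k (F : nat -> nat -> nat) (g1 g2 : k.-tuple nat -> nat) :
  recursive (fun v : 2.-tuple nat => F (tnth v ord0) (tnth v ord_max)) ->
  recursive g1 -> recursive g2 -> recursive (fun v => F (g1 v) (g2 v)).
Proof.
move=> rF r1 r2.
have rg (i : 'I_2) : recursive (if i == ord0 then g1 else g2) by case: ifP.
have := Rec_comp rF rg; congr recursive; apply: funext => v.
by rewrite !tnth_mktuple.
Qed.

Lemma recursive_succ k (g : k.-tuple nat -> nat) :
  recursive g -> recursive (fun v => (g v).+1).
Proof.
move=> rg; have := Rec_comp Rec_succ (fun _ => rg); congr recursive.
by apply: funext => v; rewrite /thead tnth_mktuple.
Qed.

Lemma recursive_const k c : recursive (fun _ : k.-tuple nat => c).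
Proof.
elim: c => [|c IH]; last exact: recursive_succ.
have r0 : forall i : 'I_0, recursive (fun _ : k.-tuple nat => 0%N) by case.
exact: (Rec_comp Rec_zero r0).
Qed.

Lemma recursive_primrec2 (F S : nat -> nat -> nat) (b : nat -> nat) :
  recursive (fun v : 1.-tuple nat => b (tnth v ord0)) ->
  recursive (fun v : 2.-tuple nat => S (tnth v ord0) (tnth v ord_max)) ->
  (forall x, F 0%N x = b x) -> (forall i x, F i.+1 x = S (F i x) x) ->
  recursive (fun v : 2.-tuple nat => F (tnth v ord0) (tnth v ord_max)).
Proof.
move=> rb rS F0 FS.
have rg := @recursive_comp2 3 S _ _ rS (Rec_proj (inord 1)) (Rec_proj (inord 2)).
apply: (Rec_primrec rb rg) => [v|i v]; rewrite !(tnth_nth 0%N) /= ?F0 ?FS ?inordK //=.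
Qed.

Lemma recursive_addn :
  recursive (fun v : 2.-tuple nat => tnth v ord0 + tnth v ord_max)%N.
Proof.
apply: (@recursive_primrec2 addn (fun r _ => r.+1) id) => //; first exact: Rec_proj.
exact: recursive_succ (Rec_proj _).
Qed.

Lemma recursive_muln :
  recursive (fun v : 2.-tuple nat => tnth v ord0 * tnth v ord_max)%N.
Proof.
apply: (@recursive_primrec2 muln addn (fun=> 0%N)) => //; first exact: recursive_const.
  exact: recursive_addn.
by move=> i x; rewrite mulSn addnC.
Qed.

(** The exponent is the first argument because the recursion runs on it. *)
Lemma recursive_expn :
  recursive (fun v : 2.-tuple nat => tnth v ord_max ^ tnth v ord0)%N.
Proof.
apply: (@recursive_primrec2 (fun i x => x ^ i)%N muln (fun=> 1%N)) => //.
- exact: recursive_const.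
- exact: recursive_muln.
by move=> i x; rewrite expnSr.
Qed.

(** The first summand bounds [M] of the linear relation, through [card_bmultinom]; the second bounds
    the exponent [k] from [separable_annihilator]. *)
Definition diagonal_exponent n d h := (d.+1 * (h + n).+1 ^ n + d)%N.

Lemma recursive_diagonal_exponent :
  recursive (fun v : 3.-tuple nat =>
    diagonal_exponent (tnth v ord0) (tnth v (inord 1)) (tnth v (inord 2))).
Proof.
pose r i : recursive (fun v : 3.-tuple nat => tnth v i) := Rec_proj i.
apply: (@recursive_comp2 3 addn _ _ recursive_addn _ (r _)).
apply: (@recursive_comp2 3 muln _ _ recursive_muln); first exact: recursive_succ.
apply: (@recursive_comp2 3 (fun i x => x ^ i)%N _ _ recursive_expn (r _)).
exact/recursive_succ/(@recursive_comp2 3 addn _ _ recursive_addn).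
Qed.

End Recursive.

(** * Explicit bounds for the diagonal *)

Lemma is_least_exists (S : nat -> Prop) m b :
  S m -> (m <= b)%N -> exists2 k, is_least S k & (k <= b)%N.
Proof.
move=> Sm mb; have exS : exists k, `[< S k >] by exists m; apply/asboolP.
case: (ex_minnP exS) => k /asboolP Sk kmin; exists k.
  by split=> // l Sl; apply/kmin/asboolP.
by apply: leq_trans mb; apply/kmin/asboolP.
Qed.

Lemma card_bmultinom n N : (#|{: 'X_{1..n < N.+1}}| <= N.+1 ^ n)%N.
Proof.
pose F (m : 'X_{1..n < N.+1}) := [ffun i : 'I_n => inord (m i) : 'I_N.+1].
have F_inj : injective F.
  move=> m1 m2 /ffunP E; apply/val_inj/mnmP => i; have := E i; rewrite !ffunE.
  have lt (m : 'X_{1..n < N.+1}) : (m i < N.+1)%N.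
    apply: leq_ltn_trans (bmdeg m); rewrite mdegE (bigD1 i) //=; exact: leq_addr.
  by move/(congr1 val) => /=; rewrite !inordK.
by have := leq_card _ F_inj; rewrite card_ffun !card_ord.
Qed.

Lemma diagonal_annihilator (K : fieldType) p n d h (f : mpseries n K)
    (P : {poly {mpoly K[n]}}) :
  p \in [pchar K] -> (0 < n)%N -> P != 0 -> ps_root P f ->
  (size P <= d.+1)%N -> (pheight P <= h)%N ->
  exists e R, [/\ (e <= diagonal_exponent n d h)%N, R != 0, ps_root R (diagonal f),
    (size R <= (p ^ e).+1)%N & (pheight R <= p ^ e)%N].
Proof.
move=> charK n_gt0 P0 /ps_rootP Pf sP hP.
have p_prime := pcharf_prime charK.
have [k [Q [kd Qf DQf sQ hQ]]] := separable_annihilator charK P0 Pf sP.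
have [c [x0 cx0] cE] :=
  diagonal_relation n_gt0 charK Qf DQf sQ (leq_trans hQ hP).
set M := (d.+1 * _)%N in c x0 cx0 cE *.
(* The relation concerns [f^(p^k)]; since diagonals commute with [p^k]-th powers, it is an equation
   for [diagonal f] with exponents shifted by [k]. *)
pose R : {poly {mpoly K[1]}} :=
  \sum_x (c x *: 'X_[const_mnm 1 x.2])%:P * 'X^(p ^ (k + x.1)).
have charp l : [pchar K].-nat (p ^ l)%N by rewrite pnatX pnatE // charK.
have coefR i m : (R`_i)@_m =
    \sum_x c x * ((m == const_mnm 1 x.2) && (i == p ^ (k + x.1))%N)%:R.
  rewrite coef_sum raddf_sum; apply: eq_bigr => x _ /=.
  rewrite coefCM coefXn; case: eqP => _; last by rewrite mulr0 mcoeff0 andbF mulr0.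
  by rewrite mulr1 mcoeffZ mcoeffX eq_sym andbT.
exists (M + k)%N, R; split.
- by rewrite leq_add // leq_mul2l card_bmultinom orbT.
(* Distinct pairs give distinct monomials [x^s Y^(p^(k+j))], so each [c x] is a coefficient of
   [R]. *)
- apply: contraNneq cx0 => R0.
  have := coefR (p ^ (k + x0.1))%N (const_mnm 1 x0.2); rewrite R0 coef0 mcoeff0.
  rewrite (bigD1 x0) //= !eqxx mulr1 big1 ?addr0 => [<- //|x xx0].
  case: andP => [[/eqP/mnmP/(_ ord0) e1 /eqP e2]|]; last by rewrite mulr0.
  case/eqP: xx0; apply/eqP; rewrite -pair_eqE; apply/andP; split; apply/eqP/val_inj => /=.
    have := expnI (prime_gt1 p_prime) e2; move/eqP; rewrite eqn_add2l => /eqP //.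
  by move: e1; rewrite !const_mnmE.
- apply/ps_rootP; rewrite -[RHS]cE /ps_horner rmorph_sum horner_sum.
  apply: eq_bigr => x _; rewrite rmorphM /= map_polyC map_polyXn.
  rewrite hornerM hornerC hornerXn.
  by rewrite expnD exprM (diagonal_exp _ n_gt0 (charp k)).
- apply: leq_trans (size_sum _ _ _) _; apply/bigmax_leqP => x _.
  apply: leq_trans (size_polyMleq _ _) _.
  rewrite size_polyC size_polyXn; apply: (@leq_trans (p ^ (k + x.1)).+1).
    by case: (_ != 0).
  by rewrite ltnS leq_exp2l ?prime_gt1 // addnC leq_add2r -ltnS.
apply/pheight_leP => i; rewrite coef_sum; apply: msize_sum_le => x _.
rewrite coefCM coefXn; case: eqP => _; last by rewrite mulr0 msize0.
rewrite mulr1; apply: leq_trans (msizeZ_le _ _) _.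
rewrite msizeX ltnS mdegE big_ord1 const_mnmE.
by apply: leq_trans (ltnW (ltn_ord _)) _; rewrite leq_exp2l ?prime_gt1 // leq_addr.
Qed.

Theorem theorem1p3 :
  exists A : 3.-tuple nat -> nat,
    recursive A /\
    forall (K : fieldType) (p : nat), p \in [pchar K] ->
    forall n d h : nat, (0 < n)%N -> (0 < d)%N -> (0 < h)%N ->
    forall f : mpseries n K,
      ps_algebraic f -> degree_at_most f d -> height_at_most f h ->
      let a := A [tuple n; d; h] in
      [/\ ps_algebraic (diagonal f),
          degree_at_most (diagonal f) (p ^ a)%N
        & height_at_most (diagonal f) (a ^ 2 * p ^ a.+1)%N].
Proof.
eexists; split; first exact: recursive_diagonal_exponent.
move=> K p charK n d h n_gt0 d_gt0 h_gt0 f _.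
move=> [d' [[P1 [P10 sP1 P1f]] _] d'd] [h' [[P2 [P20 P2f hP2]] _] h'h] a.
have aE : a = diagonal_exponent n d h.
  by rewrite /a !(tnth_nth 0%N) /= !inordK.
have [P [P0 Pf sP hP]] := minimal_annihilator P10 P1f P20 P2f.
have sPd : (size P <= d.+1)%N by apply: leq_trans sP (leq_trans sP1 _).
have hPh : (pheight P <= h)%N by rewrite (leq_trans hP) // hP2.
have [e [R [ea R0 Rf sR hR]]] := diagonal_annihilator charK n_gt0 P0 Pf sPd hPh.
rewrite -aE in ea.
have p_gt1 := prime_gt1 (pcharf_prime charK).
have pe : (p ^ e <= p ^ a)%N by rewrite leq_exp2l.
split; first by exists R.
- apply: (@is_least_exists _ (p ^ e)%N) => //.
  by exists R.
apply: (@is_least_exists _ (pheight R)); first by exists R.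
apply: leq_trans hR (leq_trans pe _).
(* The height is in fact at most [p^a]; positivity of [a] gives [p^a <= a^2 p^(a+1)]. *)
have a_gt0 : (0 < a)%N by rewrite aE /diagonal_exponent addn_gt0 d_gt0 orbT.
apply: leq_trans (leq_pmull _ _); last by rewrite expn_gt0 a_gt0.
by rewrite leq_exp2l.
Qed.
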